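(* Let $A$ be a quadratic algebra over a field $\mathbf{k}$ on generators $x_1,\dots,x_n$, and let $\rho:A\to M_n(A)$ be an algebra map such that $$\sum_{i,j}r_{ij}\big(\rho^j{}_{ik}+x_i\delta_{jk}\big)=0\quad\forall k\qquad\text{whenever}\qquad\sum_{i,j}r_{ij}x_ix_j=0\ \text{ in }A\quad(r_{ij}\in\mathbf{k}),$$ where $\rho^j{}_{ik}\in A$ are the matrix entries of $\rho(x_j)$ and $\delta_{jk}$ is the Kronecker delta. Then: (1) $\Omega^1$, defined as a free left $A$-module with basis $\mathrm{d}x_1,\dots,\mathrm{d}x_n$ and with right module structure $$(a\,\mathrm{d}x_i)b:=\sum_k(a\rho(b)_{ik})\,\mathrm{d}x_k,\qquad a,b\in A,$$ is an $A$-bimodule. (2) $\mathrm{d}:A\to\Omega^1$ defined by $\mathrm{d}(1)=0$, $\mathrm{d}(x_i)=\mathrm{d}x_i$ and extended as a derivation is well defined and makes $(\Omega^1,\mathrm{d})$ into a first order differential calculus on $A$. (3) The partial derivatives $\partial_i:A\to A$ defined by $\mathrm{d}a=\sum_i(\partial_ia)\,\mathrm{d}x_i$ for all $a\in A$ obey the twisted derivation rule $$\partial_i(ab)=\sum_j\partial_j(a)\rho(b)_{ji}+a\,\partial_i(b)\qquad\text{for all }a,b\in A.$$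
   Context: A quadratic algebra on generators $x_1,\dots,x_n$ is $A=\mathbf{k}\langle x_1,\dots,x_n\rangle/(\Re)$ with $\Re$ a set of homogeneous polynomials of degree two and $x_1,\dots,x_n$ a basis of $A_1$. Algebra maps are unital. A first order differential calculus on a unital algebra $A$ is a pair $(\Omega^1,\mathrm{d})$ where $\Omega^1$ is an $A$-bimodule, $\mathrm{d}:A\to\Omega^1$ is a linear map with $\mathrm{d}(ab)=(\mathrm{d}a)b+a\,\mathrm{d}b$ for all $a,b\in A$, and the map $A\otimes A\to\Omega^1$, $a\otimes b\mapsto a\,\mathrm{d}b$, is surjective. *)

(* Defs.v *)
From HB Require Import structures.
From mathcomp Require Import all_boot all_order all_algebra.
From mathcomp Require Export finmap monalg.

Set Implicit Arguments.
Unset Strict Implicit.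
Unset Printing Implicit Defensive.

Import GRing.Theory.
Local Open Scope ring_scope.

(* The free algebra k<X_1, ..., X_n>: the monoid algebra of the free monoid of
   words over 'I_n (multiplication of words is concatenation). *)
Notation freeAlg k n := {malg k[{fmonom 'I_n}]}.
Notation freeX k i := (mkmalgU (fmu i) (1 : k)).

Section QuadraticAlgebra.
Variables (k : fieldType) (n : nat).
Local Notation F := (freeAlg k n).

Definition homogeneous (d : nat) (f : F) : Prop :=
  forall m : {fmonom 'I_n}, m \in msupp f -> fdeg m = d.

(* f belongs to the two-sided ideal (Rel) of the free algebra *)
Definition in_ideal (Rel : F -> Prop) (f : F) : Prop :=
  exists s : seq (F * F * F),
    (forall t, t \in s -> Rel t.1.2) /\
    f = \sum_(t <- s) t.1.1 * t.1.2 * t.2.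

(* A = k<x_1, ..., x_n>/(Rel), presented by the quotient map pi.  The degree
   one component A_1 is the image of the span of the X_i, i.e. the span of
   the x_i, so that x_1, ..., x_n being a basis of A_1 amounts to their
   linear independence. *)
Record quadratic_presentation (A : algType k) (x : 'I_n -> A)
    (Rel : F -> Prop) (pi : {lrmorphism F -> A}) : Prop := {
  quad_homogeneous : forall f, Rel f -> homogeneous 2 f;
  quad_gen : forall i, pi (freeX k i) = x i;
  quad_surj : forall a, exists f, pi f = a;
  quad_ker : forall f, pi f = 0 <-> in_ideal Rel f;
  quad_indep : forall c : 'I_n -> k,
    \sum_i c i *: x i = 0 -> forall i, c i = 0
}.

Definition is_quadratic_algebra (A : algType k) (x : 'I_n -> A) : Prop :=
  exists Rel pi, quadratic_presentation x Rel pi.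

End QuadraticAlgebra.

Section Calculus.
Variables (k : fieldType) (A : algType k) (M : lmodType A).

(* The left A-module M, with the right action ract, is an A-bimodule over k:
   the two actions commute and induce the same k-vector space structure, the
   left one being c, w |-> c%:A *: w. *)
Record is_bimodule (ract : M -> A -> M) : Prop := {
  ractDl : forall v w a, ract (v + w) a = ract v a + ract w a;
  ractDr : forall v a b, ract v (a + b) = ract v a + ract v b;
  ract1 : forall v, ract v 1 = v;
  ractM : forall v a b, ract v (a * b) = ract (ract v a) b;
  ractA : forall a v b, a *: ract v b = ract (a *: v) b;
  ract_scalar : forall (c : k) v, ract v c%:A = c%:A *: v
}.

Record is_derivation (ract : M -> A -> M) (d : A -> M) : Prop := {
  der_linear : forall (c : k) a b, d (c *: a + b) = c%:A *: d a + d b;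
  der_leibniz : forall a b, d (a * b) = ract (d a) b + a *: d b
}.

Record is_fodc (ract : M -> A -> M) (d : A -> M) : Prop := {
  fodc_bimodule : is_bimodule ract;
  fodc_derivation : is_derivation ract d;
  fodc_surj : forall w, exists s : seq (A * A),
    w = \sum_(p <- s) p.1 *: d p.2
}.

End Calculus.

(* A unital k-algebra map A -> M_n(A): a ring morphism which sends c *: a to
   c%:A *: rho a (M_n(A) is a k-algebra through k -> A). *)
Notation mxAlgMap A n := {lrmorphism A -> 'M[A]_n | GRing.in_alg A \; *:%R}.

(* The free left A-module Omega^1 is 'rV[A]_n, with basis the row vectors
   dx i; the coordinate of w on dx i is w 0 i. *)
Section Omega.
Variables (k : fieldType) (A : algType k) (n : nat).

Definition dx (i : 'I_n) : 'rV[A]_n := delta_mx 0 i.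

Lemma dx_coord (w : 'rV[A]_n) : w = \sum_i w 0 i *: dx i.
Proof. exact: row_sum_delta. Qed.

Lemma coord_sum_dx (a : 'I_n -> A) i : (\sum_j a j *: dx j) 0 i = a i.
Proof.
rewrite summxE (bigD1 i) //= !mxE !eqxx mulr1 big1 ?addr0 // => j ne_ji.
by rewrite !mxE eqxx eq_sym (negPf ne_ji) mulr0.
Qed.

(* (\sum_i w_i dx_i) b = \sum_i \sum_k (w_i rho(b)_ik) dx_k *)
Definition omega_ract (rho : A -> 'M[A]_n) (w : 'rV[A]_n) (b : A) : 'rV[A]_n :=
  \sum_i \sum_l (w 0 i * rho b i l) *: dx l.

Lemma omega_ractE rho a i b :
  omega_ract rho (a *: dx i) b = \sum_l (a * rho b i l) *: dx l.
Proof.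
rewrite /omega_ract (bigD1 i) //= [X in _ + X]big1 ?addr0 => [|j ne_ji].
  by apply: eq_bigr => l _; rewrite !mxE !eqxx mulr1.
by apply: big1 => l _; rewrite !mxE (negPf ne_ji) andbF mulr0 mul0r scale0r.
Qed.

Definition extends_dx (x : 'I_n -> A) (rho : A -> 'M[A]_n)
    (d : A -> 'rV[A]_n) : Prop :=
  [/\ is_derivation (omega_ract rho) d, d 1 = 0 & forall i, d (x i) = dx i].

Definition are_partials (d : A -> 'rV[A]_n) (pd : 'I_n -> A -> A) : Prop :=
  forall a, d a = \sum_i pd i a *: dx i.

End Omega.

(* Main.v *)
From HB Require Import structures.
Require Import Defs.
From mathcomp Require Import all_boot all_order all_algebra.

Set Implicit Arguments.
Unset Strict Implicit.
Unset Printing Implicit Defensive.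

Import GRing.Theory.
Local Open Scope ring_scope.

(** The only hard point is that [d] is well defined.  A derivation [d] of [A]
    with values in the row space [A^n], where [b] acts on the right by
    [rho b], is the same thing as a [k]-linear ring morphism from [A] to
    (n+1) x (n+1) matrices of the block triangular form

      a |-> [ a   d a   ]
            [ 0   rho a ]

    because the upper right block of a product of two such matrices is
    [a * d b + (d a) (rho b)] ([der_mxM]): multiplicativity of the morphism is
    the Leibniz rule of [d].  So it is enough to construct this morphism.

    On the free algebra it exists by the universal property
    ([free_algebra_lift]): send each generator [X_i] to the matrix with blocks
    [x_i], [dx_i] and [rho x_i].  It descends to [A] as soon as it kills the
    relations.  A relation is of the form [\sum_ij r_ij X_i X_j]
    ([homogeneous2_sum]); both diagonal blocks of its image vanish because it
    is zero in [A], and the coordinate on [dx_l] of the upper right block is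
    [\sum_ij r_ij (rho(x_j)_il + x_i delta_jl)], which is zero precisely by
    the hypothesis on [rho] ([extends_dx_exists]).

    Everything else is formal.  The right action is [w |-> w *m rho b], so
    that [Omega^1] is a bimodule since [rho] is multiplicative; [d] is
    determined by its values on generators of [A]; the elements [d x_i] span
    [Omega^1] on the left; and the twisted derivation rule is the Leibniz rule
    read coordinate by coordinate. *)

(** * Free algebras and their quotients *)

Section FreeAlgebra.
Variables (R : nzRingType) (I : choiceType).
Local Notation F := {malg R[{fmonom I}]}.

(** Words grow by one letter on the left, to fit the use of the Leibniz rule
    [d (x_i a) = (d x_i) a + x_i (d a)] in which only [d a] is unknown. *)
Lemma free_algebra_ind (P : F -> Prop) :
    P 1 ->
    (forall c f g, P f -> P g -> P (c *: f + g)) ->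
    (forall i f, P f -> P (mkmalgU (fmu i) 1 * f)) ->
  forall f, P f.
Proof.
move=> P1 PD PX f.
have P0 : P 0 by rewrite -(addNr 1) -scaleN1r; apply: PD.
rewrite (monalgE f).
apply: (big_ind P) => // [g h Pg Ph|m _].
  by rewrite -[g]scale1r; apply: PD.
have Pm: P (mkmalgU m 1).
  case: m => s; elim: s => [|i s IHs].
    by rewrite -fmoneE; exact: P1.
  have ->: FMonom (i :: s) = mmul (fmu i) (FMonom s).
    by apply/eqP; rewrite fmP fmM fmU.
  by move: (PX i _ IHs); rewrite malgM_def fgmulUU mulr1.
have ->: mkmalgU m f@_m = f@_m *: mkmalgU m 1 + 0 :> F.
  rewrite addr0; apply/malgP => m'.
  by rewrite mcoeffZ !mcoeffU mulrnAr mulr1.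
exact: PD.
Qed.

Variables (S : nzRingType) (phi : {rmorphism R -> S}) (u : I -> S).

Definition word_prod (m : {fmonom I}) : S := \prod_(i <- (m : seq I)) u i.

Lemma word_prod_mmorphism : mmorphism word_prod.
Proof.
split=> [m1 m2|]; first by rewrite /word_prod fmM big_cat.
by rewrite /word_prod fm1 big_nil.
Qed.

HB.instance Definition _ :=
  monalg.isMultiplicative.Build {fmonom I} S word_prod word_prod_mmorphism.

(** The scalars of [S] are given by a central morphism [phi] rather than by an
    algebra structure, because matrices over an [R]-algebra [A] come with
    scalars in [A] and not in [R]. *)
Lemma free_algebra_lift : (forall c y, phi c * y = y * phi c) ->
  exists T : {rmorphism F -> S},
    (forall i, T (mkmalgU (fmu i) 1) = u i) /\
    (forall c f, T (c *: f) = phi c * T f).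
Proof.
move=> phiC.
have mulT : monoid_morphism (mmap phi word_prod : F -> S).
  split; first exact: mmap1.
  by apply: (commr_mmap_is_multiplicative _).1 => g m m'; apply: phiC.
pose TM := GRing.isMonoidMorphism.Build F S (mmap phi word_prod) mulT.
pose T : {rmorphism F -> S} := HB.pack (mmap phi word_prod) TM.
exists T; split=> [i|c f] /=; last exact: mmapZ.
by rewrite mmapU /= rmorph1 mul1r /word_prod fmU big_seq1.
Qed.

End FreeAlgebra.

(** Universal property of the quotient [A] of [F].  The preimages under [pi]
    are selected by the choice operator of [F]. *)
Lemma rmorph_factor (F A S : nzRingType) (pi : {rmorphism F -> A})
    (T : {rmorphism F -> S}) :
    (forall a, exists f, pi f = a) -> (forall f, pi f = 0 -> T f = 0) ->
  exists U : {rmorphism A -> S}, forall f, U (pi f) = T f.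
Proof.
move=> pi_surj kerT.
have sur a : exists f, pi f == a by have [f <-] := pi_surj a; exists f.
pose s a := xchoose (sur a).
have piK a : pi (s a) = a by apply/eqP/(xchooseP (sur a)).
pose U a := T (s a).
have UE f : U (pi f) = T f.
  by apply/eqP; rewrite -subr_eq0 -rmorphB kerT // rmorphB /= piK subrr.
have Uadd : zmod_morphism U.
  by move=> a b; rewrite -(piK a) -(piK b) -rmorphB !UE rmorphB.
have Umul : monoid_morphism U.
  split=> [|a b]; first by rewrite -(rmorph1 pi) UE rmorph1.
  by rewrite -(piK a) -(piK b) -rmorphM !UE rmorphM.
pose Ua := GRing.isZmodMorphism.Build A S U Uadd.
pose Um := GRing.isMonoidMorphism.Build A S U Umul.
by exists (HB.pack U Ua Um : {rmorphism A -> S}).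
Qed.

Lemma homogeneous2_sum (k : fieldType) n (f : freeAlg k n) :
  homogeneous 2 f ->
  f = \sum_i \sum_j f@_(mmul (fmu i) (fmu j)) *: (freeX k i * freeX k j).
Proof.
move=> deg_f; apply/malgP => m; rewrite raddf_sum /=.
under eq_bigr => i _.
  rewrite raddf_sum /=.
  under eq_bigr => j _ do rewrite mcoeffZ malgM_def fgmulUU mulr1 mcoeffU1.
  over.
have wordE i j : (mmul (fmu i) (fmu j) == m) = ([:: i; j] == m :> seq _).
  by rewrite fmP fmM !fmU.
have [fm|] := boolP (m \in msupp f); last first.
  move/mcoeff_outdom=> fm0; rewrite fm0 big1 // => i _; apply: big1 => j _.
  by case: eqP => [->|_]; rewrite ?fm0 ?mul0r ?mulr0.
have := deg_f _ fm; rewrite fdegE.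
case Em: (m : seq _) => [|i [|j []]] //= _.
have Em' : mmul (fmu i) (fmu j) = m by apply/eqP; rewrite wordE Em.
rewrite (bigD1 i) //= (bigD1 j) //= Em' eqxx mulr1.
rewrite !big1 ?addr0 // => [i' ne_i|j' ne_j].
  by apply: big1 => j' _; rewrite wordE Em !eqseq_cons (negPf ne_i) mulr0.
by rewrite wordE Em !eqseq_cons (negPf ne_j) andbF mulr0.
Qed.

(** * One-forms and partial derivatives *)

Section Omega.
Variables (k : fieldType) (n : nat) (A : algType k).
Implicit Type w : 'rV[A]_n.

(** Over a noncommutative [A] a scalar matrix on the right multiplies the
    entries on the right; it agrees with the left scaling here because [c%:A]
    is central. *)
Lemma mul_mx_alg m p (c : k) (M : 'M[A]_(m, p)) :
  M *m (c%:A)%:M = c%:A *: M.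
Proof.
apply/matrixP => i j; rewrite !mxE (bigD1 j) //= big1 => [|l ne_lj].
  by rewrite mxE eqxx addr0 mulr_algl mulr_algr.
by rewrite mxE (negPf ne_lj) mulr0.
Qed.

Lemma omega_ract_mulmx (rho : A -> 'M[A]_n) w b :
  omega_ract rho w b = w *m rho b.
Proof.
apply/rowP => l; rewrite /omega_ract exchange_big /=.
rewrite (eq_bigr (fun l => (\sum_i w 0 i * rho b i l) *: dx A l)).
  by rewrite coord_sum_dx mxE.
by move=> j _; rewrite scaler_suml.
Qed.

Variable rho : mxAlgMap A n.

Lemma omega_bimodule : is_bimodule (omega_ract rho).
Proof.
split=> [v w a|v a b|v|v a b|a v b|c v]; rewrite !omega_ract_mulmx.
- exact: mulmxDl.
- by rewrite rmorphD mulmxDr.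
- by rewrite rmorph1 mulmx1.
- by rewrite rmorphM mulmxA.
- exact: scalemxAl.
- by rewrite linearZ /= rmorph1 scalemx1 mul_mx_alg.
Qed.

Variable x : 'I_n -> A.

Lemma extension_fodc d : extends_dx x rho d -> is_fodc (omega_ract rho) d.
Proof.
case=> der_d _ dxE; split=> //; first exact: omega_bimodule.
move=> w; exists [seq (w 0 i, x i) | i <- index_enum 'I_n].
by rewrite big_map /= {1}[w]dx_coord; apply: eq_bigr => i _; rewrite dxE.
Qed.

Lemma partials_twisted d pd : extends_dx x rho d -> are_partials d pd ->
  forall i a b, pd i (a * b) = \sum_j pd j a * rho b j i + a * pd i b.
Proof.
move=> [[_ leibD] _ _] dE i a b.
have coord c : pd i c = d c 0 i by rewrite dE coord_sum_dx.
rewrite !coord leibD omega_ract_mulmx !mxE; congr (_ + _).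
by apply: eq_bigr => j _; rewrite dE coord_sum_dx.
Qed.

(** * Derivations as block triangular representations *)

(** The block [w] is kept independent of [a], so that these matrices can serve
    to construct the derivation [d] for which [w = d a]. *)
Definition der_mx (a : A) (w : 'rV[A]_n) : 'M[A]_n.+1 :=
  block_mx (a%:M : 'M_1) w 0 (rho a).

(** With [v = d a] and [w = d b] the new upper right block is the right-hand
    side of the Leibniz rule for [d (a * b)]. *)
Lemma der_mxM a b v w :
  der_mx a v * der_mx b w = der_mx (a * b) (a *: w + v *m rho b).
Proof.
rewrite /der_mx -[LHS]/(_ *m _) (@mulmx_block _ 1 n 1 n 1 n).
rewrite !mulmx0 !mul0mx !add0r !addr0 -scalar_mxM mul_scalar_mx.
by rewrite (rmorphM rho).
Qed.

Lemma der_mx1 : der_mx 1 0 = 1.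
Proof.
rewrite -[RHS]/((1 : A)%:M) (@scalar_mx_block _ 1 n).
by rewrite /der_mx (rmorph1 rho).
Qed.

Lemma der_mxZD (c : k) a b v w :
  (c%:A)%:M * der_mx a v + der_mx b w = der_mx (c *: a + b) (c%:A *: v + w).
Proof.
rewrite /der_mx -[X in X + _]/(_ *m _) mul_scalar_mx (@scale_block_mx _ 1 n 1 n).
rewrite (@add_block_mx _ 1 n 1 n) scaler0 addr0 linearP /= scale_scalar_mx.
by rewrite -raddfD /= -scalerAl mul1r.
Qed.

Lemma der_mxE a w l : der_mx a w 0 (rshift 1 l) = w 0 l.
Proof.
have ->: 0 = lshift n (0 : 'I_1) by apply: val_inj.
exact: block_mxEur.
Qed.

Lemma der_mx0 : der_mx 0 0 = 0.
Proof. by rewrite /der_mx !raddf0; apply: (@block_mx0 _ 1 n 1 n). Qed.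

(** * Derivations on a quadratic algebra *)

Section Presentation.
Variables (Rel : freeAlg k n -> Prop) (pi : {lrmorphism freeAlg k n -> A}).
Hypothesis presA : quadratic_presentation x Rel pi.

Let pi_gen := quad_gen presA.
Let pi_surj := quad_surj presA.

Lemma derivation_unique d d' :
  extends_dx x rho d -> extends_dx x rho d' -> d' =1 d.
Proof.
case=> [[linD leibD] D1 Dx] [[linD' leibD'] D'1 D'x] a.
have [f <-] := pi_surj a; elim/free_algebra_ind: f => [|c f g IHf IHg|i f IHf].
- by rewrite rmorph1 D1.
- by rewrite linearP linD linD' IHf IHg.
- by rewrite rmorphM /= leibD leibD' pi_gen Dx D'x IHf.
Qed.

(** The morphism [T] from the free algebra and its factor [U] through [A] are
    the block triangular representations described at the top; [d] is the
    upper right block of [U]. *)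
Lemma extends_dx_exists :
    (forall r : 'M[k]_n, \sum_i \sum_j r i j *: (x i * x j) = 0 ->
     forall l, \sum_i \sum_j
       r i j *: (rho (x j) i l + x i * (j == l)%:R) = 0) ->
  exists d, extends_dx x rho d.
Proof.
move=> rho_rel.
pose phi : {rmorphism k -> 'M[A]_n.+1} := scalar_mx \o in_alg A.
have phiE c (M : 'M[A]_n.+1) : phi c * M = c%:A *: M by exact: mul_scalar_mx.
have phiC c M : phi c * M = M * phi c by rewrite phiE -mul_mx_alg.
have [T [TX TZ]] := free_algebra_lift (fun i => der_mx (x i) (dx A i)) phiC.
have T_der f : exists w, T f = der_mx (pi f) w.
  elim/free_algebra_ind: f => [|c f g [v Tf] [w Tg]|i f [w Tf]].
  - by exists 0; rewrite !rmorph1 der_mx1.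
  - by exists (c%:A *: v + w); rewrite rmorphD TZ Tf Tg der_mxZD linearP.
  - exists (x i *: w + dx A i *m rho (pi f)).
    by rewrite rmorphM TX Tf der_mxM rmorphM /= pi_gen.
have T_rel f : Rel f -> T f = 0.
  move=> Rf; have pif: pi f = 0.
    apply/(quad_ker presA); exists [:: (1, f, 1)]; split=> [t|].
      by rewrite inE => /eqP->.
    by rewrite big_seq1 mul1r mulr1.
  have [w] := T_der f; rewrite pif => Tf.
  suff w0: w = 0 by rewrite Tf w0 der_mx0.
  apply/rowP => l; rewrite mxE -(der_mxE 0) -Tf.
  have fE := homogeneous2_sum (quad_homogeneous presA Rf).
  pose r : 'M[k]_n := \matrix_(i, j) f@_(mmul (fmu i) (fmu j)).
  (* the entry [l] of the block is the left-hand side of the hypothesis on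
     [rho] for the coefficients of [f] *)
  rewrite -[RHS](rho_rel r _ l).
    rewrite {1}fE rmorph_sum summxE; apply: eq_bigr => i _.
    rewrite rmorph_sum summxE; apply: eq_bigr => j _.
    rewrite TZ rmorphM !TX phiE der_mxM mxE der_mxE -rowE !mxE eqxx /=.
    by rewrite mulr_algl addrC (eq_sym l).
  rewrite -[RHS]pif {1}fE rmorph_sum; apply: eq_bigr => i _.
  rewrite rmorph_sum; apply: eq_bigr => j _.
  by rewrite mxE /= linearZ rmorphM /= !pi_gen.
have T_ker f : pi f = 0 -> T f = 0.
  move/(quad_ker presA)=> [s [Rs ->]]; rewrite rmorph_sum big_seq big1 // => t ts.
  by rewrite !rmorphM (T_rel _ (Rs t ts)) mulr0 mul0r.
have [U UE] := rmorph_factor pi_surj T_ker.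
pose d a : 'rV[A]_n := @ursubmx _ 1 n 1 n (U a).
have U_der a : U a = der_mx a (d a).
  have [f <-] := pi_surj a; have [w Tf] := T_der f.
  by rewrite /d UE Tf /der_mx (@block_mxKur _ 1 n 1 n).
have dE a w : U a = der_mx a w -> d a = w.
  by rewrite /d => ->; apply: (@block_mxKur _ 1 n 1 n).
exists d; split=> [|| i].
- split=> [c a b|a b]; apply: dE.
    have [f <-] := pi_surj a; have [g <-] := pi_surj b.
    by rewrite -linearP UE rmorphD TZ -!UE !U_der der_mxZD linearP.
  by rewrite rmorphM !U_der der_mxM omega_ract_mulmx addrC.
- by apply: dE; rewrite rmorph1 der_mx1.
- by apply: dE; rewrite -pi_gen UE TX pi_gen.
Qed.

End Presentation.

End Omega.

Theorem proposition8p4 (k : fieldType) (n : nat) (A : algType k)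
    (x : 'I_n -> A) (quadA : is_quadratic_algebra x) (rho : mxAlgMap A n)
    (rho_rel : forall r : 'M[k]_n,
      \sum_i \sum_j r i j *: (x i * x j) = 0 ->
      forall l : 'I_n,
        \sum_i \sum_j r i j *: (rho (x j) i l + x i * (j == l)%:R) = 0) :
  [/\ (* (1) *)
      is_bimodule (omega_ract rho),
      (* (2) *)
      (exists d, extends_dx x rho d /\
         forall d', extends_dx x rho d' -> d' =1 d) /\
      (forall d, extends_dx x rho d -> is_fodc (omega_ract rho) d) &
      (* (3) *)
      forall d, extends_dx x rho d ->
        (exists pd, are_partials d pd) /\
        forall pd, are_partials d pd ->
          forall i a b,
            pd i (a * b) = \sum_j pd j a * rho b j i + a * pd i b].
Proof.
have [Rel [pi presA]] := quadA.
split; [exact: omega_bimodule | split=> [|d ext_d] | move=> d ext_d].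
- have [d ext_d] := extends_dx_exists presA rho_rel.
  by exists d; split=> // d'; move/(derivation_unique presA ext_d).
- exact: extension_fodc ext_d.
- split=> [|pd pdE]; last exact: partials_twisted ext_d pdE.
  by exists (fun i a => d a 0 i) => a; apply: dx_coord.
Qed.
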